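(* Let $a,b$ be positive integers and let $h^{a,b}_n$ be the number of tilings of the honeycomb strip $H_n$ by monomers, each colored with one of $a$ colors, and dimers, each colored with one of $b$ colors. Then for $n\ge 4$, $$h^{a,b}_n=a\,h^{a,b}_{n-1}+b\,h^{a,b}_{n-2}+ab\,h^{a,b}_{n-3}+b^2\,h^{a,b}_{n-4},$$ with initial conditions $h^{a,b}_0=1$, $h^{a,b}_1=a$, $h^{a,b}_2=a^2+b$, $h^{a,b}_3=a^3+3ab$.
   Context: The honeycomb strip $H_n$ consists of $n$ regular hexagons arranged in two rows, numbered $1,\dots,n$ from the bottom left so that odd-numbered hexagons form the bottom row and even-numbered ones the top row; hexagon $i$ shares an edge with hexagons $i\pm1$ and $i\pm2$ (when they exist), and with no others. A monomer is a single hexagon; a dimer is a pair of edge-adjacent hexagons, i.e. either $\{i,i+1\}$ (slanted) or $\{i,i+2\}$ (horizontal). A tiling of $H_n$ is a partition of its hexagons into monomers and dimers; colored tilings are counted as distinct if the tilings or the color assignments differ. *)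

(* Defs.v *)
From mathcomp Require Import all_boot.

Set Implicit Arguments.
Unset Strict Implicit.
Unset Printing Implicit Defensive.

(* The element i : 'I_n stands for the hexagon numbered i + 1 of H_n. *)
Definition hex_adj (n : nat) : rel 'I_n :=
  fun i j => [|| j == i + 1 :> nat, j == i + 2 :> nat,
                 i == j + 1 :> nat | i == j + 2 :> nat].

Definition monomer (n : nat) (B : {set 'I_n}) : bool :=
  [exists i : 'I_n, B == [set i]].

Definition dimer (n : nat) (B : {set 'I_n}) : bool :=
  [exists i : 'I_n, exists j : 'I_n, hex_adj i j && (B == [set i; j])].

Definition tiling (n : nat) (P : {set {set 'I_n}}) : bool :=
  partition P [set: 'I_n] && [forall B in P, monomer B || dimer B].

(* A color assignment is extended by None outside the tiles of P, so that each
   assignment on the tiles is counted exactly once: Some (inl _) is a monomer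
   color, Some (inr _) a dimer color. *)
Definition coloring (a b n : nat) (P : {set {set 'I_n}})
    (c : {ffun {set 'I_n} -> option ('I_a + 'I_b)}) : bool :=
  [forall B, match c B with
             | None => B \notin P
             | Some (inl _) => (B \in P) && monomer B
             | Some (inr _) => (B \in P) && dimer B
             end].

Definition colored_tilings (a b n : nat) :
    {set {set {set 'I_n}} * {ffun {set 'I_n} -> option ('I_a + 'I_b)}} :=
  [set t | tiling t.1 && coloring t.1 t.2].

Definition h (a b n : nat) : nat := #|colored_tilings a b n|.

(* Main.v *)
Require Import Defs.
From mathcomp Require Import all_boot.
From mathcomp Require Import zify.

(** Counting colorings tile by tile, [h a b n] is the sum over all partitions
    of the strip of the product of the block weights, where monomers weigh [a],
    dimers weigh [b] and all other blocks weigh [0]. Such a sum can be expanded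
    along the block of any chosen cell. Expanding along the last hexagon [k] of
    a strip leaves a shorter strip, except when [k] is paired with [k - 2]; the
    remaining region is then expanded along the isolated hexagon [k - 1], whose
    only possible partner is [k - 3]. *)

Set Implicit Arguments.
Unset Strict Implicit.
Unset Printing Implicit Defensive.

(** * Weighted sums over set partitions *)

Definition partition_sum (T : finType) (w : {set T} -> nat) (D : {set T}) :=
  \sum_(P : {set {set T}} | partition P D) \prod_(B in P) w B.

Lemma partition_sum0 (T : finType) (w : {set T} -> nat) :
  partition_sum w set0 = 1.
Proof.
rewrite /partition_sum (big_pred1 set0) ?big_set0 // => P.
by rewrite partition_set0.
Qed.

(** Adjoining [B] is a bijection from the partitions of [D :\: B] onto the partitions of [D] whose
    block at [x] is [B]; the factor [w B] splits off the product. *)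
Lemma partition_sum_expand (T : finType) (w : {set T} -> nat) (D : {set T}) x :
  x \in D ->
  partition_sum w D =
    \sum_(B : {set T} | (x \in B) && (B \subset D))
       w B * partition_sum w (D :\: B).
Proof.
move=> xD; rewrite /partition_sum.
rewrite (partition_big (fun P => pblock P x)
           (fun B : {set T} => (x \in B) && (B \subset D))) /=; last first.
  move=> P parP; have xP : x \in cover P by rewrite (cover_partition parP).
  by rewrite mem_pblock xP (partitionS parP) ?pblock_mem.
apply: eq_bigr => B /andP[xB sBD]; rewrite big_distrr /=.
have B0 : B != set0 by apply/set0Pn; exists x.
(* [B] contains [x], which the blocks of [Q] avoid, so deleting [B] from [B |: Q] gives back [Q]. *)
have notin Q : partition Q (D :\: B) -> B \notin Q.
  move=> parQ; apply/negP => BQ; have /subsetP/(_ x xB) := partitionS parQ BQ.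
  by rewrite inE xB.
rewrite (reindex_onto (fun Q : {set {set T}} => B |: Q)
           (fun P : {set {set T}} => P :\ B)); last first.
  move=> P /andP[parP /eqP <-]; apply: setD1K.
  by rewrite pblock_mem // (cover_partition parP).
apply: eq_big => [Q|Q /andP[/andP[_ _]]]; last first.
  by move/eqP=> <-; rewrite big_setU1 ?setD11 //= setD1K ?setU11.
apply/idP/idP => [/andP[/andP[parP _] /eqP eqQ]|parQ].
  by rewrite -eqQ; apply: partitionD1 => //; apply: setU11.
have parP : partition (B |: Q) D.
  rewrite -(setID D B) (setIidPr sBD); apply: partitionU1 => //.
  by rewrite disjoints_subset setCD subsetUr.
rewrite parP setU1K ?notin // eqxx andbT /=; apply/eqP.
by apply: def_pblock => //; [case/and3P: parP | apply: setU11].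
Qed.

(** * Colored tilings as weighted partitions *)

Definition tile_weight (a b : nat) {n : nat} (B : {set 'I_n}) : nat :=
  a * monomer B + b * dimer B.

Lemma sum_option (T : finType) (F : option T -> nat) :
  \sum_o F o = F None + \sum_x F (Some x).
Proof.
rewrite (bigD1 None) //=; congr (_ + _).
by rewrite (reindex_omap Some id) /=; [apply: eq_bigl => x; rewrite eqxx | case].
Qed.

Lemma card_tile_colors (a b n : nat) (P : {set {set 'I_n}}) (B : {set 'I_n}) :
  #|[pred o : option ('I_a + 'I_b) | match o with
       | None => B \notin P
       | Some (inl _) => (B \in P) && monomer B
       | Some (inr _) => (B \in P) && dimer B
       end]| = if B \in P then tile_weight a b B else 1.
Proof.
rewrite -sum1_card big_mkcond /= sum_option /= big_sumType /= !inE.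
under eq_bigr do rewrite inE; under [X in _ + (_ + X)]eq_bigr do rewrite inE.
rewrite !sum_nat_const !card_ord /tile_weight.
by case: (B \in P) => /=; [case: monomer; case: dimer | rewrite !muln0].
Qed.

(** The condition on a color assignment is imposed separately at each set, so the count is a product
    over all sets; those outside [P] admit only [None] and contribute [1]. *)
Lemma card_coloring (a b n : nat) (P : {set {set 'I_n}}) :
  #|[pred c | coloring (a := a) (b := b) P c]|
    = \prod_(B in P) tile_weight a b B.
Proof.
pose F (B : {set 'I_n}) := [pred o : option ('I_a + 'I_b) | match o with
       | None => B \notin P
       | Some (inl _) => (B \in P) && monomer B
       | Some (inr _) => (B \in P) && dimer B
       end].
rewrite (eq_card (B := family F)); last first.
  by move=> c; apply: eq_forallb => B; rewrite inE.
rewrite card_family foldrE big_image /= [RHS]big_mkcond /=.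
by apply: eq_bigr => B _; rewrite card_tile_colors.
Qed.

(** A color on a block already certifies that it is a monomer or a dimer, which leaves only the
    partition condition. *)
Lemma coloring_tiling (a b n : nat) (P : {set {set 'I_n}})
    (c : {ffun {set 'I_n} -> option ('I_a + 'I_b)}) :
  coloring P c -> tiling P = partition P [set: 'I_n].
Proof.
move/forallP=> colP; rewrite /tiling andb_idr // => _.
apply/forallP => B; apply/implyP => BP.
by move: (colP B); rewrite BP; case: (c B) => [[_|_]|] //= ->; rewrite ?orbT.
Qed.

Lemma h_partition_sum (a b n : nat) :
  h a b n = partition_sum (tile_weight a b) [set: 'I_n].
Proof.
rewrite /h /partition_sum -sum1_card.
under [RHS]eq_bigr => P _ do rewrite -card_coloring -sum1_card.
rewrite pair_big_dep /=; apply: eq_bigl => -[P c]; rewrite !inE /=.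
by rewrite andbC [RHS]andbC; apply: andb_id2l => /coloring_tiling.
Qed.

(** * Expansion along the tile of a cell *)

Lemma monomer_memE (n : nat) (x : 'I_n) (B : {set 'I_n}) :
  (x \in B) && monomer B = (B == [set x]).
Proof.
apply/andP/eqP => [[xB /existsP[i /eqP eB]]|->].
  by move: xB; rewrite eB inE => /eqP->.
by split; [apply: set11 | apply/existsP; exists x].
Qed.

Lemma hex_adj_sym (n : nat) : symmetric (@hex_adj n).
Proof. by move=> i j; rewrite /hex_adj; lia. Qed.

Lemma hex_adj_neq (n : nat) (i j : 'I_n) : hex_adj i j -> i != j.
Proof. by rewrite /hex_adj -val_eqE /=; lia. Qed.

Lemma dimer_memP (n : nat) (x : 'I_n) (B : {set 'I_n}) :
  reflect (exists2 y, hex_adj x y & B = [set x; y]) ((x \in B) && dimer B).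
Proof.
apply: (iffP andP) => [[xB /existsP[i /existsP[j /andP[adj /eqP eB]]]]|[y adj ->]].
  move: xB; rewrite eB !inE => /orP[]/eqP->; first by exists j.
  by exists i; rewrite 1?hex_adj_sym // setUC.
split; first exact: set21.
by apply/existsP; exists x; apply/existsP; exists y; rewrite adj eqxx.
Qed.

(** Only two kinds of sets containing [x] can have nonzero weight: the singleton and the pairs of
    [x] with an adjacent cell. *)
Lemma tile_sum_expand (a b n : nat) (D : {set 'I_n}) (x : 'I_n) :
  x \in D ->
  partition_sum (tile_weight a b) D =
    a * partition_sum (tile_weight a b) (D :\ x)
    + b * \sum_(y in D | hex_adj x y)
            partition_sum (tile_weight a b) (D :\: [set x; y]).
Proof.
move=> xD; rewrite (partition_sum_expand _ xD).
under [LHS]eq_bigr do rewrite [X in X * _]/tile_weight mulnDl.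
rewrite big_split /=; congr (_ + _).
  rewrite (bigD1 [set x]) /=; last by rewrite set11 sub1set.
  have -> : monomer [set x] by have := monomer_memE x [set x]; rewrite set11 eqxx.
  rewrite muln1 big1 ?addn0 // => B /andP[/andP[xB _] neB].
  by have := monomer_memE x B; rewrite xB (negbTE neB) /= => ->; rewrite muln0.
rewrite big_distrr /=.
(* Neighbors differ from [x], so [y] is determined by [[set x; y]] and the sum over neighbors
   becomes a sum over dimers. *)
rewrite -(big_imset (h := fun y => [set x; y])
   (A := [pred y | (y \in D) && hex_adj x y])
   (fun B => b * partition_sum (tile_weight a b) (D :\: B))) /=; last first.
  move=> y z /andP[_ /hex_adj_neq xy] _ eyz.
  have : y \in [set x; z] by rewrite -eyz set22.
  by rewrite !inE eq_sym (negbTE xy) => /eqP.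
rewrite [LHS]big_mkcond [RHS]big_mkcond; apply: eq_bigr => B _ /=.
have -> : (B \in [set [set x; y] | y in [pred y | (y \in D) && hex_adj x y]])
          = [&& x \in B, B \subset D & dimer B].
  apply/imsetP/and3P => [[y /andP[yD adj] eB]|[xB sBD dB]].
    have /andP[xB dB] : (x \in B) && dimer B by apply/dimer_memP; exists y.
    split=> //; rewrite eB; apply/subsetP => z; rewrite !inE.
    by case/orP => /eqP->.
  have /dimer_memP[y adj eB] : (x \in B) && dimer B by rewrite xB.
  exists y => //; rewrite inE adj andbT.
  by apply: (subsetP sBD); rewrite eB set22.
by case: (x \in B); case: (B \subset D); case: (dimer B);
   rewrite //= ?muln1 ?muln0 ?mul0n.
Qed.

(** * Recurrences for prefixes with and without a gap *)

Definition prefix_set (n k : nat) : {set 'I_n} := [set i : 'I_n | i < k].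

(** The missing cell is [k]: for [k.+3 <= n], this region is what remains of the prefix of length
    [k.+3] without the horizontal dimer of [k] and [k.+2]. *)
Definition gap_set (n k : nat) : {set 'I_n} :=
  [set i : 'I_n | (i < k) || (i == k.+1 :> nat)].

Section StripExpansion.

Variables a b n : nat.

Let S k := partition_sum (tile_weight a b) (prefix_set n k).
Let G k := partition_sum (tile_weight a b) (gap_set n k).

Lemma prefix_sum0 : S 0 = 1.
Proof.
by rewrite /S (_ : prefix_set n 0 = set0) ?partition_sum0 //.
Qed.

Lemma prefix_sum1 : 1 <= n -> S 1 = a.
Proof.
move=> le1n; pose x := Ordinal le1n.
rewrite /S (tile_sum_expand _ _ (x := x)) ?inE //.
rewrite big_pred0 => [|y]; last by rewrite !inE /hex_adj /=; lia.
rewrite (_ : _ :\ x = prefix_set n 0); last first.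
  by apply/setP => i; rewrite !inE -val_eqE /=; lia.
by rewrite -/(S 0) prefix_sum0 muln0 addn0 muln1.
Qed.

Lemma prefix_sum2 : 2 <= n -> S 2 = a * S 1 + b * S 0.
Proof.
move=> le2n; pose x := Ordinal le2n; pose y := Ordinal (ltnW le2n).
rewrite /S (tile_sum_expand _ _ (x := x)) ?inE //.
rewrite (big_pred1 y) => [|z]; last by rewrite !inE /hex_adj -val_eqE /=; lia.
by congr (_ * _ + _ * _); congr partition_sum;
   apply/setP => i; rewrite !inE -!val_eqE /=; lia.
Qed.

(** The last cell [k.+2] is a monomer, or is paired with [k.+1], leaving a prefix, or with [k],
    leaving a gap. *)
Lemma prefix_sum3 k : k.+3 <= n -> S k.+3 = a * S k.+2 + b * (S k.+1 + G k).
Proof.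
move=> lekn; pose x := Ordinal lekn; pose y := Ordinal (ltnW lekn).
pose z := Ordinal (ltnW (ltnW lekn)).
rewrite /S /G (tile_sum_expand _ _ (x := x)) ?inE //.
rewrite (bigD1 y) /=; last by rewrite !inE /hex_adj /=; lia.
rewrite (big_pred1 z) => [|i]; last first.
  by rewrite !inE /hex_adj -!val_eqE /=; lia.
by congr (_ * _ + _ * (_ + _)); congr partition_sum;
   apply/setP => i; rewrite !inE -!val_eqE /=; lia.
Qed.

Lemma gap_sum0 : 2 <= n -> G 0 = a.
Proof.
move=> le2n; pose x := Ordinal le2n.
rewrite /G (tile_sum_expand _ _ (x := x)) ?inE //.
rewrite big_pred0 => [|y]; last by rewrite !inE /hex_adj /=; lia.
rewrite (_ : _ :\ x = prefix_set n 0); last first.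
  by apply/setP => i; rewrite !inE -val_eqE /=; lia.
by rewrite -/(S 0) prefix_sum0 muln0 addn0 muln1.
Qed.

(** The cell beyond the gap is [k.+2]; with [k.+1] absent, its only neighbor in the region is [k],
    and either choice leaves a prefix. *)
Lemma gap_sumS k : k.+3 <= n -> G k.+1 = a * S k.+1 + b * S k.
Proof.
move=> lekn; pose x := Ordinal lekn; pose y := Ordinal (ltnW (ltnW lekn)).
rewrite /G /S (tile_sum_expand _ _ (x := x)) ?inE /= ?eqxx ?orbT //.
rewrite (big_pred1 y) => [|i]; last by rewrite !inE /hex_adj -!val_eqE /=; lia.
by congr (_ * _ + _ * _); congr partition_sum;
   apply/setP => i; rewrite !inE -!val_eqE /=; lia.
Qed.

End StripExpansion.

(* The prefix sums depend on the ambient strip 'I_n only through the bound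
   k <= n; comparing them with a sequence independent of n avoids transporting
   partitions between strips of different lengths. *)
Fixpoint strip_count (a b k : nat) : nat :=
  match k with
  | 0 => 1
  | 1 => a
  | 2 => a ^ 2 + b
  | 3 => a ^ 3 + 3 * a * b
  | (((k0.+1 as k1).+1 as k2).+1 as k3).+1 =>
      a * strip_count a b k3 + b * strip_count a b k2
      + a * b * strip_count a b k1 + b ^ 2 * strip_count a b k0
  end.

Lemma prefix_sumE (a b n k : nat) : k <= n ->
  partition_sum (tile_weight a b) (prefix_set n k) = strip_count a b k.
Proof.
elim/ltn_ind: k => -[|[|[|[|k]]]] IH lekn.
- exact: prefix_sum0.
- exact: prefix_sum1.
- rewrite prefix_sum2 // prefix_sum1 ?prefix_sum0 //=; last lia.
  by rewrite muln1 mulnn.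
- rewrite prefix_sum3 // gap_sum0 ?prefix_sum2 ?prefix_sum1 ?prefix_sum0 //=;
    try lia.
(* Substituting the gap sum into the expansion of the prefix yields the terms with [a * b] and
   [b ^ 2]. *)
- rewrite prefix_sum3 // gap_sumS; last lia.
  by rewrite !IH /=; try lia.
Qed.

Lemma h_strip_count (a b n : nat) : h a b n = strip_count a b n.
Proof.
rewrite h_partition_sum -(prefix_sumE a b (leqnn n)).
by congr partition_sum; apply/setP => i; rewrite !inE ltn_ord.
Qed.

Theorem theorem3 (a b : nat) (ha : 0 < a) (hb : 0 < b) :
  (forall n : nat, 4 <= n ->
     h a b n = a * h a b (n - 1) + b * h a b (n - 2)
               + a * b * h a b (n - 3) + b ^ 2 * h a b (n - 4)) /\
  h a b 0 = 1 /\
  h a b 1 = a /\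
  h a b 2 = a ^ 2 + b /\
  h a b 3 = a ^ 3 + 3 * a * b.
Proof.
split; last by rewrite !h_strip_count.
by move=> [|[|[|[|n]]]] // _; rewrite !h_strip_count !subSS !subn0.
Qed.
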